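(* Let $k=\mathbb{F}_q$ be a finite field of odd characteristic. Let $\gamma\in\operatorname{PGL}_2(k)$, $\gamma\neq 1$, and let $m$ be the order of $\gamma$. Let $V$ be the open subvariety $\mathbb{P}^1\setminus\operatorname{Fix}_\gamma$ of $\mathbb{P}^1$, where $\operatorname{Fix}_\gamma$ is the set of fixed points of $\gamma$ in $\mathbb{P}^1(\overline{k})$. Then, for any positive integer $n$, $$\left|\operatorname{Fix}_\gamma\binom{V}{n}(k)\right|=a_V(n/m),\qquad \left|\operatorname{Fix}_\gamma\binom{V}{n}^{\mathrm{rat}}\right|=b_V\big(|V(k)|/m,\;n/m\big),$$ with the convention that $a_V(x)=0=b_V(r,x)$ if $x$ is not a positive integer.
   Context: $\overline{k}$ is an algebraic closure of $k$ and $\sigma$ is the Frobenius automorphism $\sigma(x)=x^q$ of $\overline{k}$. For an algebraic variety $V$ defined over $k$, a rational $n$-set of $V$ is an unordered set $S=\{t_1,\dots,t_n\}$ of $n$ different points of $V(\overline{k})$ that is globally Galois-invariant, $S=S^{\sigma}$. The set of rational $n$-sets of $V$ is denoted $\binom{V}{n}(k)$, and $\binom{V}{n}^{\mathrm{rat}}$ denotes the subset of those rational $n$-sets that contain at least one $k$-rational point of $V$. Put $a_V(n)=\left|\binom{V}{n}(k)\right|$, and, for $0\le r\le |V(k)|$, let $b_V(r,n)$ be the number of rational $n$-sets $S$ of $V$ with $S\cap Z\neq\emptyset$, where $Z$ is any subset of $V(k)$ with $|Z|=r$ (the number depends only on $r$, not on the choice of $Z$). The group $\operatorname{PGL}_2(k)$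 acts on $\mathbb{P}^1(\overline{k})$ by projective transformations and $\gamma$ acts on the rational $n$-sets of $V=\mathbb{P}^1\setminus\operatorname{Fix}_\gamma$ by $S\mapsto\gamma(S)$. For a set $X$ with an action of $\gamma$, $\operatorname{Fix}_\gamma X$ denotes the subset of elements of $X$ fixed by $\gamma$; thus $\operatorname{Fix}_\gamma\binom{V}{n}(k)$ is the set of rational $n$-sets $S$ of $V$ with $\gamma(S)=S$, and similarly for $\binom{V}{n}^{\mathrm{rat}}$. *)

(* Defs.v *)
From mathcomp Require Import all_boot all_order all_algebra all_fingroup.
From mathcomp Require Import finfield.
From mathcomp Require Import finmap.
From mathcomp Require Import boolp classical_sets functions cardinality.

Set Implicit Arguments.
Unset Strict Implicit.
Unset Printing Implicit Defensive.

Import Order.TTheory GRing.Theory Num.Theory.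
Local Open Scope ring_scope.

(* [fset_set A] is empty when A is infinite, so card_set is meaningful for    *)
(* finite sets only; see finite_Vk and finite_ratnsets.                       *)
Definition card_set (T : choiceType) (A : set T) : nat := #|` fset_set A|.

Definition ext0 (f : nat -> nat) (x : rat) : nat :=
  if (x \is a Num.nat) && (0 < x) then f (Num.truncn x) else 0%N.

Lemma ext0_div (f : nat -> nat) (n m : nat) : (0 < n)%N -> (0 < m)%N ->
  ext0 f (n%:R / m%:R) = if (m %| n)%N then f (n %/ m)%N else 0%N.
Proof.
move=> n0 m0; rewrite /ext0 divr_gt0 ?ltr0n// andbT.
have m0' : m%:R != 0 :> rat by rewrite pnatr_eq0 -lt0n.
case: ifP => [/natrP[d nmd]|nat_nm].
  have -> : n = (d * m)%N.
    by apply/eqP; rewrite -(eqr_nat rat) natrM -nmd mulfVK.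
  by rewrite natrM mulfK// natrK dvdn_mull// mulnK.
by case: ifP => // mn; rewrite (Qnat_dvd mn) in nat_nm.
Qed.

Definition scalarGL (k : finFieldType) : {set {'GL_2[k]}} :=
  [set g | is_scalar_mx (GLval g)].

Lemma scalarGL_group (k : finFieldType) : group_set (scalarGL k).
Proof.
apply/group_setP; split=> [|g h]; rewrite !inE.
  by apply/is_scalar_mxP; exists 1.
move=> /is_scalar_mxP[a ga] /is_scalar_mxP[b hb]; apply/is_scalar_mxP.
by exists (a * b); rewrite GL_ME ga hb scalar_mxM.
Qed.
Canonical scalarGL_groupType (k : finFieldType) := Group (scalarGL_group k).

Lemma scalarGL_norm (k : finFieldType) (g : {'GL_2[k]}) :
  g \in 'N(scalarGL k)%g.
Proof.
rewrite inE; apply/fintype.subsetP=> _ /imsetP[h + ->].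
rewrite !inE => /is_scalar_mxP[a ha]; apply/is_scalar_mxP; exists a.
rewrite conjgE mulgA GL_ME GL_ME GL_VE ha.
have -> : (GLval g)^-1 * a%:M = a%:M * (GLval g)^-1.
  exact: scalar_mxC.
by rewrite -mulrA mulVr ?mulr1// GL_unit.
Qed.

(* Every g : {'GL_2[k]} normalises the scalars (scalarGL_norm), so this       *)
(* finGroupType is the whole of GL_2(k) / k^*.                                *)
Definition PGL2 (k : finFieldType) := coset_of (scalarGL k).

Definition P1 (F : fieldType) := {L : {vspace 'cV[F]_2} | \dim L == 1%N}.

Lemma dim_line1 (F : fieldType) (v : 'cV[F]_2) :
  v != 0 -> \dim <[v]>%VS == 1%N.
Proof. by rewrite dim_vline => ->. Qed.

(* The point with homogeneous coordinates v.                                  *)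
Definition pt (F : fieldType) (v : 'cV[F]_2) (nzv : v != 0) : P1 F :=
  exist _ <[v]>%VS (dim_line1 nzv).

Lemma vpick_neq0 (F : fieldType) (P : P1 F) : vpick (val P) != 0.
Proof.
by rewrite vpick0; apply: contraL (valP P) => /eqP->; rewrite dimv0.
Qed.

Lemma eq_line (F : fieldType) (v w : 'cV[F]_2) :
  v != 0 -> v \in <[w]>%VS -> <[v]>%VS = <[w]>%VS.
Proof.
move=> v0 vw; apply/eqP; rewrite eqEdim -memvE vw/= !dim_vline v0.
by case: (w != 0).
Qed.

Lemma val_line (F : fieldType) (P : P1 F) : val P = <[vpick (val P)]>%VS.
Proof.
apply/eqP; rewrite eq_sym eqEdim -memvE memv_pick/=.
by rewrite (eqP (valP P)) dim_vline vpick_neq0.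
Qed.

Lemma P1_ptP (F : fieldType) (P : P1 F) :
  exists (v : 'cV[F]_2) (v0 : v != 0), P = pt v0.
Proof.
by exists (vpick (val P)), (vpick_neq0 P); apply: val_inj; exact: val_line.
Qed.

Lemma eq_ptP (F : fieldType) (v w : 'cV[F]_2) (v0 : v != 0) (w0 : w != 0) :
  pt v0 = pt w0 <-> exists c : F, v = c *: w.
Proof.
split=> [/(congr1 val)/= vw|[c vcw]]; last first.
  by apply: val_inj; apply: eq_line => //; apply/vlineP; exists c.
by apply/vlineP; rewrite -vw memv_line.
Qed.

(* Coordinatewise Frobenius x |-> x ^ q, with q = #|k|.                       *)
Definition frob_mx (k : finFieldType) (F : fieldType) (v : 'cV[F]_2) :
  'cV[F]_2 := map_mx (fun x => x ^+ #|k|) v.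

Lemma frob_mx_neq0 (k : finFieldType) (F : fieldType) (v : 'cV[F]_2) :
  v != 0 -> frob_mx k v != 0.
Proof.
apply: contraNneq => fv0; apply/eqP/colP => i; rewrite mxE.
have /colP/(_ i) := fv0; rewrite !mxE => /eqP.
by rewrite expf_eq0 => /andP[_ /eqP].
Qed.

Lemma frob_mxZ (k : finFieldType) (F : fieldType) c (v : 'cV[F]_2) :
  frob_mx k (c *: v) = c ^+ #|k| *: frob_mx k v.
Proof. by apply/colP => i; rewrite !mxE exprMn. Qed.

(* Any other generator of the line gives the same point: frobP1_pt.           *)
Definition frobP1 (k : finFieldType) (F : fieldType) (P : P1 F) : P1 F :=
  pt (frob_mx_neq0 k (vpick_neq0 P)).

Lemma frobP1_pt (k : finFieldType) (F : fieldType) (v : 'cV[F]_2)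
  (v0 : v != 0) : frobP1 k (pt v0) = pt (frob_mx_neq0 k v0).
Proof.
have /vlineP[c vc] : vpick (val (pt v0)) \in <[v]>%VS by exact: memv_pick.
by apply/eq_ptP; exists (c ^+ #|k|); rewrite vc frob_mxZ.
Qed.

Section Theory.
Variables (k : finFieldType) (K : closedFieldType) (iota : {rmorphism k -> K}).

Lemma PGL2_unit (g : {'GL_2[k]}) : map_mx iota g \in unitmx.
Proof. by rewrite map_unitmx; exact: GL_unit. Qed.

Lemma act_mx_neq0 (g : {'GL_2[k]}) (v : 'cV[K]_2) :
  v != 0 -> map_mx iota g *m v != 0.
Proof.
by apply: contraNneq => gv0; rewrite -(mulKmx (PGL2_unit g) v) gv0 mulmx0.
Qed.

(* Independent of the representatives of gamma and of P: actP1_pt.            *)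
Definition actP1 (gamma : PGL2 k) (P : P1 K) : P1 K :=
  pt (act_mx_neq0 (repr gamma) (vpick_neq0 P)).

Lemma actP1_pt (g : {'GL_2[k]}) (v : 'cV[K]_2) (v0 : v != 0) :
  actP1 (coset (scalarGL k) g) (pt v0) = pt (act_mx_neq0 g v0).
Proof.
have /vlineP[c vc] : vpick (val (pt v0)) \in <[v]>%VS by exact: memv_pick.
apply/eq_ptP; rewrite vc -scalemxAr.
have := mem_repr_coset (coset (scalarGL k) g).
rewrite val_coset ?scalarGL_norm// => /rcosetP[h].
rewrite inE => /is_scalar_mxP[a ha] ->; exists (c * iota a).
rewrite GL_ME ha -scalerA; congr (_ *: _).
have -> : a%:M * GLval g = a *: GLval g by exact: mul_scalar_mx.
by rewrite map_mxZ -scalemxAl.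
Qed.

Lemma actP1_1 (P : P1 K) : actP1 1%g P = P.
Proof.
have [v [v0 ->]] := P1_ptP P; rewrite -(coset_id (group1 _)) actP1_pt.
by apply/eq_ptP; exists 1; rewrite GL_1E (map_mx1 iota) mul1mx scale1r.
Qed.

Lemma actP1_M (g h : PGL2 k) (P : P1 K) :
  actP1 (g * h)%g P = actP1 g (actP1 h P).
Proof.
have [v [v0 ->]] := P1_ptP P.
rewrite -(coset_reprK g) -(coset_reprK h) -morphM ?scalarGL_norm// !actP1_pt.
apply/eq_ptP; exists 1; rewrite GL_ME scale1r mulmxA; congr (_ *m _).
exact: map_mxM.
Qed.

Definition FixP1 (gamma : PGL2 k) : set (P1 K) :=
  [set P | actP1 gamma P = P]%classic.

(* P^1(k) inside P^1(K): the points having homogeneous coordinates in k.      *)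
Definition ratP1 : set (P1 K) :=
  [set P | exists2 v : 'cV[k]_2, v != 0 & val P = <[map_mx iota v]>%VS]%classic.

Definition Vk (V : set (P1 K)) : set (P1 K) := (V `&` ratP1)%classic.

(* A variety V enters through its set V(K) of geometric points.               *)
Definition ratnsets (V : set (P1 K)) (n : nat) : set {fset P1 K} :=
  [set S : {fset P1 K} | [/\ ([set` S] `<=` V)%classic, #|` S| = n
             & [fset frobP1 k P | P in S]%fset = S]]%classic.

Definition meeting (Z : set (P1 K)) : set {fset P1 K} :=
  [set S : {fset P1 K} | ([set` S] `&` Z !=set0)%classic]%classic.

Definition ratnsets_rat (V : set (P1 K)) (n : nat) : set {fset P1 K} :=
  (ratnsets V n `&` meeting (Vk V))%classic.

Definition FixSets (gamma : PGL2 k) (X : set {fset P1 K}) : set {fset P1 K} :=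
  [set S : {fset P1 K} | X S /\ [fset actP1 gamma P | P in S]%fset = S]%classic.

Definition a_ (V : set (P1 K)) : rat -> nat :=
  ext0 (fun n => card_set (ratnsets V n)).

(* The choice of Z (possible when r <= |V(k)|) is immaterial: b_E.            *)
Definition b_ (V : set (P1 K)) (r : nat) : rat -> nat :=
  let Z := xget fset0 [set Z : {fset P1 K} |
                        ([set` Z] `<=` Vk V)%classic /\ #|` Z| = r]%classic in
  ext0 (fun n => card_set (ratnsets V n `&` meeting [set` Z])%classic).

Lemma finite_P1 (s : seq K) : finite_set
  [set P : P1 K | exists2 v : 'cV[K]_2, forall i, v i 0 \in s
                                      & val P = <[v]>%VS]%classic.
Proof.
have nz1 : const_mx 1 != 0 :> 'cV[K]_2.
  by apply/eqP => /colP/(_ 0)/eqP; rewrite !mxE oner_eq0.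
pose f (u : K * K) : P1 K :=
  insubd (pt nz1) <[\col_i (if i == 0 then u.1 else u.2)%R]>%VS.
pose ss : seq (K * K) := [seq (x, y) | x <- s, y <- s].
apply: (@sub_finite_set _ _ (f @` [set` ss])%classic); last first.
  exact/finite_image/finite_seq.
move=> P [v vs Pv]; exists (v 0 0, v 1 0).
  by rewrite /=; apply/allpairsP; exists (v 0 0, v 1 0); rewrite /= !vs.
apply: val_inj; rewrite /f val_insubd.
set w := \col_i _; have -> : w = v.
  apply/colP => i; rewrite !mxE; case: eqP => [->//|/eqP i0].
  by congr (v _ _); apply: val_inj; case: i i0 => [[|[|]]].
by rewrite -Pv (valP P).
Qed.

Lemma finite_Vk (V : set (P1 K)) : finite_set (Vk V).
Proof.
apply: sub_finite_set (finite_P1 [seq iota x | x <- enum k]) => P [_ [v v0 Pv]].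
by exists (map_mx iota v) => // i; rewrite mxE map_f// mem_enum.
Qed.

Lemma frob_inj : injective (fun x : K => x ^+ #|k|).
Proof.
have [p p_pr pk] := finPcharP k.
have q_nat : [pchar K].-nat #|k|.
  rewrite (card_pprimeChar pk) pnatX; apply/orP; left.
  by rewrite pnatE// (fmorph_pchar iota).
move=> x y /= xy; apply/eqP; rewrite -subr_eq0.
have : (x - y) ^+ #|k| == 0.
  by rewrite exprDn_pchar// exprNn_pchar// xy subrr.
by rewrite expf_eq0 => /andP[].
Qed.

Lemma frob_mx_inj : injective (@frob_mx k K).
Proof.
move=> v w /colP vw; apply/colP => i; have := vw i.
by rewrite !mxE => /frob_inj.
Qed.

Lemma mx2_neq0 (v : 'cV[K]_2) : v != 0 -> exists i, v i 0 != 0.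
Proof.
move=> v0; apply/existsP; rewrite -negb_forall; apply: contra v0 => /forallP v0.
by apply/eqP/colP => i; rewrite mxE; apply/eqP.
Qed.

Lemma frobP1_inj : injective (@frobP1 k K).
Proof.
move=> P Q; have [v [v0 ->]] := P1_ptP P; have [w [w0 ->]] := P1_ptP Q.
rewrite !frobP1_pt => /eq_ptP[c vw].
have [i wi0] := mx2_neq0 w0; apply/eq_ptP; exists (v i 0 / w i 0).
apply: frob_mx_inj; rewrite frob_mxZ vw; congr (_ *: _).
have /colP/(_ i) := vw; rewrite !mxE expr_div_n => ->.
by rewrite mulfK// expf_neq0.
Qed.

Lemma frobP1_rat (P : P1 K) : ratP1 P -> frobP1 k P = P.
Proof.
move=> [v v0 Pv].
have iv0 : map_mx iota v != 0 by rewrite map_mx_eq0.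
have -> : P = pt iv0 by exact: val_inj.
rewrite frobP1_pt; apply/eq_ptP; exists 1; rewrite scale1r.
by apply/colP => i; rewrite !mxE -rmorphXn expf_card.
Qed.

Lemma finite_ratnsets (V : set (P1 K)) (n : nat) : finite_set (ratnsets V n).
Proof.
have [M ME] : exists M, M = n`! by exists n`!.
pose N := (#|k| ^ M)%N.
have q1 : (1 < #|k|)%N by exact: (finNzRing_gt1 k).
have N1 : (1 < N)%N by rewrite -[1%N](exp1n M) ltn_exp2r// ME fact_gt0.
have Q0 : ('X^N - 'X : {poly K}) != 0.
  by rewrite -size_poly_eq0 size_polyDl ?size_polyXn// size_polyN size_polyX.
have [s sP] : exists s : seq K, forall x, x ^+ N = x -> x \in s.
  have [s Qs] := closed_field_poly_normal ('X^N - 'X : {poly K}).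
  exists s => x xN; rewrite -root_prod_XsubC.
  have : root ('X^N - 'X : {poly K}) x.
    by rewrite /root !hornerE xN subrr.
  by rewrite Qs rootZ// lead_coef_eq0.
have /finite_fsetP[F FE] := finite_P1 s.
apply: (@sub_finite_set _ _ [set` fpowerset F]); last exact: finite_fset.
move=> S [_ Sn SE]; rewrite /= fpowersetE; apply/fsubsetP => P PS.
have itS i : iter i (@frobP1 k K) P \in S.
  by elim: i => // i IH; rewrite iterS -SE in_imfset.
have [d [d0 dn dP]] : exists d, [/\ (0 < d)%N, (d <= n)%N
    & iter d (@frobP1 k K) P = P].
  have : looping (@frobP1 k K) P n.
    rewrite -[looping _ _ _]negbK -looping_uniq; apply/negP => ut.
    suff : (n.+1 <= n)%N by rewrite ltnn.
    rewrite -[leqRHS]Sn -[leqLHS](size_traject (@frobP1 k K) P).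
    by apply: uniq_leq_size => // Q /trajectP[i _ ->]; exact: itS.
  move=> /trajectP[i ni niE]; exists (n - i)%N.
  rewrite subn_gt0 leq_subr; split => //.
  have iter_inj : injective (iter i (@frobP1 k K)).
    by elim: i {ni niE} => // i IH x y /= /frobP1_inj/IH.
  by apply: iter_inj; rewrite -iterD subnKC// ltnW.
have NP : iter M (@frobP1 k K) P = P.
  have /dvdnP[c ->] : (d %| M)%N by rewrite ME dvdn_fact// d0.
  by elim: c => // c IH; rewrite mulSn iterD IH.
suff : [set` F]%classic P by [].
rewrite -FE /=; have [v [v0 Pv]] := P1_ptP P.
have [i vi0] := mx2_neq0 v0.
have w0 : (v i 0)^-1 *: v != 0 by rewrite scaler_eq0 negb_or invr_eq0 vi0.
set w := _ *: v in w0.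
have Pw : P = pt w0 by rewrite Pv; apply/eq_ptP; exists (v i 0); rewrite scalerKV.
exists w; last by rewrite Pw.
have wi : w i 0 = 1 by rewrite mxE mulVf.
move: w w0 Pw wi => w w0 Pw wi.
have itw m : exists2 u0 : iter m (@frob_mx k K) w != 0,
    iter m (@frobP1 k K) P = pt u0 &
    forall j, iter m (@frob_mx k K) w j 0 = w j 0 ^+ (#|k| ^ m).
  elim: m => [|m [u0 Pu uE]].
    by exists w0 => // j; rewrite expn0 expr1.
  exists (frob_mx_neq0 k u0) => [|j]; first by rewrite iterS Pu frobP1_pt.
  by rewrite iterS mxE uE -exprM -expnSr.
move=> j; apply: sP; have [u0 + uE] := itw M.
rewrite NP Pw => /eq_ptP[c wc].
have := congr1 (fun u : 'cV[K]_2 => u i 0) wc.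
rewrite /= mxE uE wi expr1n mulr1 => c1; rewrite -c1 scale1r in wc.
by rewrite /N -uE -wc.
Qed.

(* A permutation of V(k) extended by the identity commutes with Frobenius, so *)
(* it transports rational n-sets meeting Z to rational n-sets meeting Z'.     *)
Lemma count_meeting_le (V : set (P1 K)) (Z Z' : {fset P1 K}) (n : nat) :
  ([set` Z] `<=` Vk V)%classic -> ([set` Z'] `<=` Vk V)%classic ->
  #|` Z| = #|` Z'| ->
  (card_set (ratnsets V n `&` meeting [set` Z])%classic <=
   card_set (ratnsets V n `&` meeting [set` Z'])%classic)%N.
Proof.
move=> ZV Z'V cZ.
have [W WE] : exists W : {fset P1 K}, forall x, (x \in W) = (x \in Vk V).
  by exists (fset_set (Vk V)) => x; rewrite in_fset_set//; exact: finite_Vk.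
have ZW : (Z `<=` W)%fset by apply/fsubsetP => x xZ; rewrite WE inE; exact: ZV.
have Z'W : (Z' `<=` W)%fset.
  by apply/fsubsetP => x xZ; rewrite WE inE; exact: Z'V.
pose sq (Y : {fset P1 K}) : seq (P1 K) := Y ++ (W `\` Y)%fset.
have sqE (Y : {fset P1 K}) x : (Y `<=` W)%fset -> (x \in sq Y) = (x \in W).
  move=> /fsubsetP YW; rewrite mem_cat in_fsetD.
  by case: (boolP (x \in Y)) => // /YW ->.
have sq_uniq (Y : {fset P1 K}) : uniq (sq Y).
  rewrite cat_uniq !fset_uniq andbT /=; apply/hasPn => x.
  by rewrite /= in_fsetD => /andP[].
have sq_size (Y : {fset P1 K}) : (Y `<=` W)%fset -> size (sq Y) = #|` W|.
  move=> YW; rewrite size_cat [X in (_ + X)%N]cardfsDS// subnKC//.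
  exact: fsubset_leq_card.
pose pi x := if x \in W then nth x (sq Z') (index x (sq Z)) else x.
have lt_idx x : x \in W -> (index x (sq Z) < size (sq Z'))%N.
  by move=> xW; rewrite sq_size// -(sq_size Z)// index_mem sqE.
have piW x : (pi x \in W) = (x \in W).
  rewrite /pi; case: ifP => // xW; rewrite -(sqE Z')//.
  by rewrite mem_nth// lt_idx.
have pi_inj : injective pi.
  move=> x y pxy; have := piW x; rewrite pxy piW.
  move: pxy; rewrite /pi; case: ifP => xW; case: ifP => yW // + _.
  have -> : nth y (sq Z') (index y (sq Z)) = nth x (sq Z') (index y (sq Z)).
    by apply: set_nth_default; exact: lt_idx.
  move/eqP; rewrite nth_uniq ?lt_idx ?sq_uniq// => /eqP xy.
  by apply: (index_inj x) xy; rewrite sqE.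
have piZ x : x \in Z -> pi x \in Z'.
  move=> xZ; rewrite /pi (fsubsetP ZW)// /sq !index_cat xZ nth_cat.
  have : (index x Z < size Z')%N by rewrite -[size Z']cZ index_mem.
  by move=> h; rewrite h mem_nth.
have pi_frob x : frobP1 k (pi x) = pi (frobP1 k x).
  have Wfix y : y \in W -> frobP1 k y = y.
    by rewrite WE inE => -[_]; exact: frobP1_rat.
  case: (boolP (x \in W)) => xW; first by rewrite !Wfix ?piW.
  have fxW : frobP1 k x \notin W.
    by apply: contra xW => fxW; rewrite -(frobP1_inj (Wfix _ fxW)).
  by rewrite /pi (negPf xW) (negPf fxW).
have piV x : V x -> V (pi x).
  case: (boolP (x \in W)) => xW Vx; last by rewrite /pi (negPf xW).
  by have : pi x \in W; [rewrite piW|rewrite WE inE => -[]].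
pose g (S : {fset P1 K}) := [fset pi x | x in S]%fset.
have g_inj : injective g.
  move=> S T /fsetP gST; apply/fsetP => x; have := gST (pi x).
  by rewrite !(mem_imfset _ _ pi_inj).
have fin Y : finite_set (ratnsets V n `&` meeting Y)%classic.
  exact/finite_setIl/finite_ratnsets.
rewrite /card_set; set X := fset_set (_ `&` meeting [set` Z])%classic.
have -> : #|` X| = #|` [fset g S | S in X]%fset| by rewrite card_imfset.
apply/fsubset_leq_card/fsubsetP => _ /imfsetP[S /= + ->].
rewrite /X !in_fset_set// !inE => -[[SV Sn SE] [x [xS xZ]]].
split; last first.
  exists (pi x); split; last exact: piZ.
  by rewrite /= mem_imfset.
split.
- by move=> _ /imfsetP[y /= yS ->]; exact/piV/SV.
- by rewrite card_imfset.
- apply/fsetP => y; apply/imfsetP/imfsetP => -[z /= zS ->].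
    move/imfsetP : zS => [t /= tS ->]; exists (frobP1 k t); rewrite ?pi_frob//.
    by rewrite -SE in_imfset.
  move: zS; rewrite -SE => /imfsetP[t /= tS ->].
  exists (pi t); last by rewrite pi_frob.
  by rewrite SE in tS *; apply/imfsetP; exists t.
Qed.

Lemma b_E (V : set (P1 K)) (r : nat) (Z : {fset P1 K}) (x : rat) :
  ([set` Z] `<=` Vk V)%classic -> #|` Z| = r ->
  b_ V r x =
  ext0 (fun n => card_set (ratnsets V n `&` meeting [set` Z])%classic) x.
Proof.
move=> ZV Zr; rewrite /b_; set D := (X in xget _ X).
have [Z'V Z'r] : D (xget fset0 D) by apply: xgetPex; exists Z.
rewrite /ext0; case: ifP => // _; apply/eqP; rewrite eqn_leq.
by rewrite !count_meeting_le// Zr Z'r.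
Qed.

End Theory.

(* Main.v *)
Require Import Defs.
From mathcomp Require Import all_boot all_order all_algebra all_fingroup.
From mathcomp Require Import cyclic finfield.
From mathcomp Require Import finmap.
From mathcomp Require Import boolp classical_sets functions cardinality.
From mathcomp Require Import ring.

Set Implicit Arguments.
Unset Strict Implicit.
Unset Printing Implicit Defensive.

Import Order.TTheory GRing.Theory Num.Theory.
Local Open Scope ring_scope.

(* Over K, the point set V is a torsor under the centraliser of gamma: in the *)
(* affine coordinate u given by a basis of (generalised) eigenvectors of a    *)
(* matrix of gamma, V is either u <> 0 with gamma acting by u |-> z u, z a    *)
(* primitive m-th root of unity, or the affine line with gamma acting by u    *)
(* |-> u + 1, m being then the characteristic p. The isogenies u |-> u ^ m    *)
(* and u |-> u ^ p - u map V onto V, their fibres are the free gamma-orbits,  *)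
(* and they commute with Frobenius because the eigenvectors are chosen fixed  *)
(* or exchanged by it. A gamma-invariant rational n-set is thus the full      *)
(* preimage of a unique rational (n/m)-set.                                   *)

(** Let [phi] be the isogeny just described: a quotient map of V by the free action of gamma that
    commutes with Frobenius. Then S |-> [phi](S) is a bijection from the gamma-stable finite subsets
    of V onto all finite subsets of V. Its inverse is the full preimage, it divides cardinalities by
    m, and it preserves rationality in both directions ([card_invariant_sets]). This gives the first
    count.

    For the second, V(k) is itself gamma-stable, so a gamma-stable S meets V(k) exactly when
    [phi](S) meets [phi](V(k)). The latter consists of |V(k)|/m rational points, and b depends only
    on the size of the chosen set of rational points ([quotient_counts]).

    What [phi] must satisfy is checked in a coordinate by [chart_mul] and [chart_add]. The
    coordinate is chosen in [invariant_countsP] from the eigenvalues of a matrix of gamma: distinct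
    eigenvalues are either both fixed or exchanged by Frobenius, and a double one lies in k because
    the characteristic is odd. *)

Lemma imfset_stable (T : choiceType) (g : T -> T) (S : {fset T}) :
  {in S &, injective g} -> (forall x, x \in S -> g x \in S) ->
  [fset g x | x in S]%fset = S.
Proof.
move=> g_inj gS; apply/eqP; rewrite eqEfcard card_in_imfset//= leqnn andbT.
by apply/fsubsetP => _ /imfsetP[x /= xS ->]; exact: gS.
Qed.

(** * Finite subsets of a set with a free cyclic action, and of its quotient *)

Section FreeQuotient.
Variables (T : choiceType) (V : set T) (F g phi : T -> T) (m : nat).
Hypothesis m_gt0 : (0 < m)%N.
Hypothesis F_inj : injective F.
Hypothesis FV : forall x, V x -> V (F x).
Hypothesis gV : forall x, V x -> V (g x).
Hypothesis g_free : forall x i, V x -> iter i g x = x <-> (m %| i)%N.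
Hypothesis phiV : forall x, V x -> V (phi x).
Hypothesis phi_surj : forall y, V y -> exists2 x, V x & phi x = y.
Hypothesis phiF : forall x, V x -> phi (F x) = F (phi x).
Hypothesis phi_fiber : forall x y, V x -> V y ->
  phi x = phi y <-> exists i, y = iter i g x.

Let iterV i x : V x -> V (iter i g x).
Proof. by move=> Vx; elim: i => // i; exact: gV. Qed.

Let iter_mod i x : V x -> iter (i %% m) g x = iter i g x.
Proof.
move=> Vx; rewrite {2}(divn_eq i m) addnC iterD; congr iter.
by apply/esym/(g_free _ Vx); exact: dvdn_mull.
Qed.

Let g_inj : {in V &, injective g}.
Proof.
move=> x y; rewrite !inE => Vx Vy gxy.
have := (g_free m Vx).2 (dvdnn m); have := (g_free m Vy).2 (dvdnn m).
by rewrite -(prednK m_gt0) !iterSr gxy => -> ->.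
Qed.

Let iter_inj i j x : V x -> (i < m)%N -> (j < m)%N ->
  iter i g x = iter j g x -> i = j.
Proof.
move=> Vx; wlog ij : i j / (i <= j)%N.
  move=> W im jm ijE; case: (leqP i j) => [|/ltnW] ij; first exact: W.
  by apply/esym/W.
move=> im jm ijE; have [d dE] : exists d, j = (i + d)%N.
  by exists (j - i)%N; rewrite subnKC.
have /(g_free d (iterV i Vx)) : iter d g (iter i g x) = iter i g x.
  by rewrite -iterD addnC -dE.
have dm : (d < m)%N by rewrite (leq_ltn_trans _ jm)// dE leq_addl.
rewrite /dvdn modn_small// dE => /eqP ->; by rewrite addn0.
Qed.

Lemma phi_iter i x : V x -> phi (iter i g x) = phi x.
Proof. by move=> Vx; apply/esym/phi_fiber; [|exact: iterV|exists i]. Qed.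

(** Choose one point [s y] above each y in S. By freeness its fibre is the orbit listed without
    repetition by the exponents 0, ..., m - 1, and distinct fibres are disjoint. *)
Lemma fiber_fset (S : {fset T}) : ([set` S] `<=` V)%classic ->
  exists2 R : {fset T}, #|` R| = (m * #|` S|)%N &
    forall x, x \in R <-> V x /\ phi x \in S.
Proof.
move=> SV.
have [s sP] : exists s : T -> T, forall y, y \in S -> V (s y) /\ phi (s y) = y.
  have /choice[s sP] : forall y, exists x, y \in S -> V x /\ phi x = y.
    move=> y; case: (boolP (y \in S)) => [/SV/phi_surj[x Vx xy]|_].
      by exists x.
    by exists y.
  by exists s.
pose r := [seq iter i g (s y) | y <- S, i <- iota 0 m].
have r_uniq : uniq r.
  apply: allpairs_uniq; rewrite ?fset_uniq ?iota_uniq// => -[y i] [z j].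
  move=> /allpairsP[[y' i'] [/= yS]]; rewrite mem_iota /= => im [-> ->].
  move=> /allpairsP[[z' j'] [/= zS]]; rewrite mem_iota /= => jm [-> ->] E.
  have [Vy yE] := sP _ yS; have [Vz zE] := sP _ zS.
  have yz : y' = z' by rewrite -yE -zE -(phi_iter i' Vy) E phi_iter.
  by rewrite -yz in E *; rewrite (iter_inj Vy im jm E).
exists [fset x in r]%fset.
  by rewrite card_fseq undup_id// size_allpairs size_iota mulnC.
move=> x; rewrite in_fset /=; split.
  move=> /allpairsP[[y i] [/= yS _ ->]]; have [Vy yE] := sP _ yS.
  by rewrite phi_iter// yE; split => //; exact: iterV.
move=> [Vx xS]; have [Vy /(phi_fiber Vy Vx)[i ->]] := sP _ xS.
apply/allpairsP; exists (phi x, i %% m)%N; split => //=.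
  by rewrite mem_iota/= ltn_mod.
by rewrite iter_mod.
Qed.

Lemma imfset_phiV (S : {fset T}) : ([set` S] `<=` V)%classic ->
  ([set` [fset phi x | x in S]%fset] `<=` V)%classic.
Proof. by move=> SV _ /imfsetP[x /= /SV Vx ->]; exact: phiV. Qed.

(** The fibres of [phi] are the [g]-orbits, so a [g]-stable set is a union of fibres and is
    recovered from its image. *)
Lemma mem_saturated (S : {fset T}) (x : T) : ([set` S] `<=` V)%classic ->
  (forall y, y \in S -> g y \in S) -> V x ->
  (phi x \in [fset phi y | y in S]%fset) = (x \in S).
Proof.
move=> SV gS Vx; apply/idP/idP => [|xS]; last exact: in_imfset.
move=> /imfsetP[y /= yS /esym/(phi_fiber (SV _ yS) Vx)[i ->]].
by elim: i => // i; exact: gS.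
Qed.

Lemma card_saturated (S : {fset T}) : ([set` S] `<=` V)%classic ->
  (forall y, y \in S -> g y \in S) ->
  #|` S| = (m * #|` [fset phi x | x in S]%fset|)%N.
Proof.
move=> SV gS; have [R <- RP] := fiber_fset (imfset_phiV SV).
congr #|` _|; apply/fsetP => x; apply/idP/idP => [xS|/RP[Vx]].
  by apply/RP; split; [exact: SV|exact: in_imfset].
by rewrite mem_saturated.
Qed.

(** The bijection S |-> [phi](S), with the full preimage as inverse. The conditions [PX] and [PY],
    which correspond under it, let one statement serve both counts: they will be trivial, or express
    that rational points are met. *)
Lemma card_invariant_sets (n : nat) (X Y : set {fset T})
    (PX PY : set {fset T}) :
  finite_set X ->
  X = [set S : {fset T} | ([set` S] `<=` V)%classic /\
    [/\ #|` S| = n, [fset F x | x in S]%fset = S,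
    [fset g x | x in S]%fset = S & PX S]]%classic ->
  Y = [set S : {fset T} | ([set` S] `<=` V)%classic /\
    [/\ (m * #|` S|)%N = n, [fset F x | x in S]%fset = S & PY S]]%classic ->
  (forall S : {fset T}, ([set` S] `<=` V)%classic ->
     (forall y, y \in S -> g y \in S) ->
     PX S <-> PY [fset phi x | x in S]%fset) ->
  card_set X = card_set Y.
Proof.
move=> finX XE YE XY.
have stab (h : T -> T) (S : {fset T}) :
    [fset h x | x in S]%fset = S -> forall x, x \in S -> h x \in S.
  by move=> hS x xS; rewrite -hS in_imfset.
have YX : Y = [set [fset phi x | x in S]%fset | S in X]%classic.
  rewrite XE YE; apply/seteqP;
    split => [S [SV [Sn FS PS]]|_ [S [SV [Sn FS gS PS]] <-]].
    have [R Rn RP] := fiber_fset SV.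
    have RV : ([set` R] `<=` V)%classic by move=> x /RP[].
    have gR x : x \in R -> g x \in R.
      move=> /RP[Vx xS]; apply/RP; split; first exact: gV.
      by rewrite (phi_iter 1).
    have RS : [fset phi x | x in R]%fset = S.
      apply/fsetP => y; apply/imfsetP/idP => [[x /= /RP[_ xS] ->]//|yS].
      have [x Vx xy] := phi_surj (SV _ yS).
      by exists x => //=; apply/RP; rewrite xy.
    exists R => //; split => //; split.
    - by rewrite Rn.
    - apply: imfset_stable => [x y _ _|x /RP[Vx xS]]; first exact: F_inj.
      apply/RP; split; first exact: FV.
      by rewrite phiF//; exact: stab.
    - apply: imfset_stable => // x y xR yR; apply: g_inj; rewrite inE;
        exact: RV.
    - by apply/XY; rewrite ?RS.
  split; first exact: imfset_phiV.
  split.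
  - by rewrite -card_saturated//; exact: stab.
  - apply: imfset_stable => [x y _ _|_ /imfsetP[x /= xS ->]].
      exact: F_inj.
    by rewrite -phiF; [rewrite in_imfset//=; exact: stab|exact: SV].
  - by apply/XY => //; exact: stab.
have finY : finite_set Y by rewrite YX; exact: finite_image.
have -> : card_set Y = #|` [fset [fset phi x | x in (S : {fset T})]
    | S in fset_set X]%fset|.
  congr #|` _|; apply/fsetP => S; rewrite in_fset_set// YX; apply/idP/imfsetP.
    by rewrite inE => -[R XR <-]; exists R => //=; rewrite in_fset_set// inE.
  by move=> [R /= + ->]; rewrite in_fset_set// !inE => XR; exists R.
rewrite card_in_imfset//= => S R; rewrite !in_fset_set// !inE XE.
move=> -[SV [_ _ gS _]] -[RV [_ _ gR _]] SR; apply/fsetP => x.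
apply/idP/idP => xS.
  by rewrite -(mem_saturated RV (stab _ _ gR) (SV _ xS)) -SR in_imfset.
by rewrite -(mem_saturated SV (stab _ _ gS) (RV _ xS)) SR in_imfset.
Qed.

End FreeQuotient.

(** * Determinants of pairs of plane vectors *)

Lemma ord2E (i : 'I_2) : (i == 0) || (i == 1).
Proof. by case: i => [[|[|]]]. Qed.

Section Cross.
Variable F : fieldType.
Implicit Types v w : 'cV[F]_2.

(** The determinant of the matrix with columns v and w; it turns equality of projective points into
    an equation. *)
Definition cross v w : F := v 0 0 * w 1 0 - v 1 0 * w 0 0.

Lemma crossDl v1 v2 w : cross (v1 + v2) w = cross v1 w + cross v2 w.
Proof. by rewrite /cross !mxE; ring. Qed.

Lemma crossZl a v w : cross (a *: v) w = a * cross v w.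
Proof. by rewrite /cross !mxE; ring. Qed.

Lemma crossC v w : cross w v = - cross v w.
Proof. by rewrite /cross; ring. Qed.

Lemma crossvv v : cross v v = 0.
Proof. by rewrite /cross; ring. Qed.

Lemma crossDr v w1 w2 : cross v (w1 + w2) = cross v w1 + cross v w2.
Proof. by rewrite /cross !mxE; ring. Qed.

Lemma crossZr a v w : cross v (a *: w) = a * cross v w.
Proof. by rewrite /cross !mxE; ring. Qed.

Lemma cross0l w : cross 0 w = 0.
Proof. by rewrite /cross !mxE; ring. Qed.

Lemma col2P v w : v 0 0 = w 0 0 -> v 1 0 = w 1 0 -> v = w.
Proof.
move=> h0 h1; apply/colP => i.
by case/orP: (ord2E i) => /eqP ->.
Qed.

(** Cramer's rule. *)
Lemma cross_decomp n1 n2 v : cross n1 n2 != 0 ->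
  v = (cross v n2 / cross n1 n2) *: n1 + (cross n1 v / cross n1 n2) *: n2.
Proof.
by rewrite /cross => nz; apply: col2P; rewrite !mxE; field.
Qed.

Lemma cross_eq0P v w : w != 0 ->
  reflect (exists c, v = c *: w) (cross v w == 0).
Proof.
move=> w0; apply: (iffP eqP) => [vw|[c ->]]; last first.
  by rewrite crossZl crossvv mulr0.
have [i wi] : exists i, w i 0 != 0.
  apply/existsP; rewrite -negb_forall; apply: contra w0 => /forallP w0.
  by apply/eqP/colP => i; rewrite mxE; apply/eqP.
exists (v i 0 / w i 0); move: vw wi; rewrite /cross => /subr0_eq vw.
case/orP: (ord2E i) => /eqP -> wi; apply: col2P; rewrite !mxE;
  apply: (mulIf wi); rewrite mulrAC divfK// 1?[RHS]mulrC ?vw// -vw mulrC.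
Qed.

Lemma pt_eqE v w (v0 : v != 0) (w0 : w != 0) :
  pt v0 = pt w0 <-> cross v w = 0.
Proof.
rewrite eq_ptP; split=> [vw|/eqP/(cross_eq0P v w0)//].
by apply/eqP/cross_eq0P.
Qed.

(** If every vector were an eigenvector of A, then testing (1,0), (0,1) and (1,1) would show that A
    is scalar. *)
Lemma nonscalar_cyclic (A : 'M[F]_2) : ~~ is_scalar_mx A ->
  exists e, cross e (A *m e) != 0.
Proof.
apply: contraNP => /forallNP Ae.
have {}Ae e : cross e (A *m e) = 0 by apply/eqP/negP => /negP; exact: Ae.
have mE (u : 'cV[F]_2) i : (A *m u) i 0 = A i 0 * u 0 0 + A i 1 * u 1 0.
  by rewrite mxE !big_ord_recl big_ord0 addr0; congr (_ + A i _ * u _ 0);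
    apply: val_inj.
pose u (x y : F) : 'cV[F]_2 := \col_i (if i == 0 then x else y).
have E x y : x * (A 1 0 * x + A 1 1 * y) - y * (A 0 0 * x + A 0 1 * y) = 0.
  by have := Ae (u x y); rewrite /cross !mE !mxE.
have A10 : A 1 0 = 0 by have := E 1 0 => <-; ring.
have A01 : A 0 1 = 0.
  by apply/eqP; rewrite -oppr_eq0; apply/eqP; have := E 0 1 => <-; ring.
have A11 : A 1 1 = A 0 0.
  have := E 1 1; rewrite A10 A01 => A11.
  by apply/subr0_eq; rewrite -[RHS]A11; ring.
apply/is_scalar_mxP; exists (A 0 0); apply/matrixP => i j; rewrite mxE.
by case/orP: (ord2E i) => /eqP ->; case/orP: (ord2E j) => /eqP ->;
  rewrite ?eqxx ?mulr1n ?A11 ?A10 ?A01.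
Qed.

End Cross.

(** * Frobenius and the action of PGL_2 on the projective line *)

Section ProjectiveLine.
Variables (k : finFieldType) (K : closedFieldType) (iota : {rmorphism k -> K}).

Lemma cross_map (v w : 'cV[k]_2) :
  cross (map_mx iota v) (map_mx iota w) = iota (cross v w).
Proof. by rewrite /cross !mxE rmorphB !rmorphM. Qed.

Lemma card_pchar_nat : [pchar K].-nat #|k|.
Proof.
have [p p_pr pk] := finPcharP k.
rewrite (card_pprimeChar pk) pnatX; apply/orP; left.
by rewrite pnatE// (fmorph_pchar iota).
Qed.

Lemma frob_mxD (v w : 'cV[K]_2) :
  frob_mx k (v + w) = frob_mx k v + frob_mx k w.
Proof.
by apply/colP => i; rewrite !mxE exprDn_pchar ?card_pchar_nat.
Qed.

Lemma frob_mx_map m n (A : 'M[k]_(m, n)) :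
  map_mx (fun x => x ^+ #|k|) (map_mx iota A) = map_mx iota A.
Proof. by apply/matrixP => i j; rewrite !mxE -rmorphXn expf_card. Qed.

(** A matrix of gamma has its entries in k, hence fixed by Frobenius. *)
Lemma frob_act (gamma : PGL2 k) (P : P1 K) :
  frobP1 k (actP1 iota gamma P) = actP1 iota gamma (frobP1 k P).
Proof.
have [v [v0 ->]] := P1_ptP P; rewrite -(coset_reprK gamma).
rewrite !(actP1_pt, frobP1_pt); apply/eq_ptP; exists 1; rewrite scale1r.
set A := GLval _.
have mE (u : 'cV[K]_2) : map_mx iota A *m u =
    u 0 0 *: map_mx iota (col 0 A) + u 1 0 *: map_mx iota (col 1 A).
  apply/colP => i; rewrite !mxE !big_ord_recl big_ord0 addr0 !mxE.
  by congr (_ + _); rewrite mulrC; congr (u _ _ * iota (A _ _)); apply: val_inj.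
have fE (u : 'cV[k]_2) : frob_mx k (map_mx iota u) = map_mx iota u.
  exact: frob_mx_map.
by rewrite !mE frob_mxD !frob_mxZ !fE !mxE.
Qed.

Lemma actP1_X (gamma : PGL2 k) i (P : P1 K) :
  actP1 iota (gamma ^+ i)%g P = iter i (actP1 iota gamma) P.
Proof. by elim: i => [|i IH]; rewrite ?actP1_1// expgS actP1_M IH. Qed.

Lemma actP1_inj (gamma : PGL2 k) : injective (actP1 iota gamma).
Proof.
move=> P Q PQ; rewrite -(actP1_1 iota P) -(actP1_1 iota Q).
by rewrite -(mulVg gamma) !actP1_M PQ.
Qed.

Lemma not_scalar_repr (gamma : PGL2 k) : gamma != 1%g ->
  ~~ is_scalar_mx (GLval (repr gamma)).
Proof.
apply: contraNN => sc; apply/eqP; rewrite -(coset_reprK gamma).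
by apply: coset_id; rewrite inE.
Qed.

(** A cyclic vector of a non-scalar representative, taken over k, spans a point that gamma moves. *)
Lemma actP1_faithful (gamma : PGL2 k) :
  (forall P : P1 K, actP1 iota gamma P = P) -> gamma = 1%g.
Proof.
move=> fixP; apply/eqP/negPn/negP => /not_scalar_repr/nonscalar_cyclic[e].
apply/negP; rewrite negbK.
have [->|e0] := eqVneq e 0; first by rewrite cross0l.
have ie0 : map_mx iota e != 0 by rewrite map_mx_eq0.
have := fixP (pt ie0); rewrite -{1}(coset_reprK gamma) actP1_pt.
move=> /pt_eqE; rewrite -map_mxM cross_map => /eqP.
by rewrite fmorph_eq0 crossC oppr_eq0.
Qed.

Lemma frob_fixed (x : K) : x ^+ #|k| = x -> exists a, x = iota a.
Proof.
move=> xq; have : root (map_poly iota ('X^#|k| - 'X)) x.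
  by rewrite rmorphB /= map_polyXn map_polyX /root !hornerE xq subrr.
rewrite finField_genPoly rmorph_prod /= /root horner_prod => /eqP/eqP.
move=> /prodf_eq0[a _]; rewrite -/(root _ _).
by rewrite rmorphB /= map_polyX map_polyC root_XsubC => /eqP ->; exists a.
Qed.

(** Once one coordinate is scaled to 1, Frobenius fixes the vector itself and not only its line, so
    all coordinates are roots of X^q - X, that is, lie in k. *)
Lemma frobP1_fixed (P : P1 K) : frobP1 k P = P -> ratP1 iota P.
Proof.
have [v [v0 ->]] := P1_ptP P; have [i vi] := mx2_neq0 v0.
have [w [wi wv]] : exists w : 'cV[K]_2, w i 0 = 1 /\ v = v i 0 *: w.
  by exists ((v i 0)^-1 *: v); rewrite mxE mulVf// scalerKV.
have w0 : w != 0 by apply: contraNneq vi => w0; rewrite wv w0 scaler0 mxE.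
have -> : pt v0 = pt w0 by apply/eq_ptP; exists (v i 0).
rewrite frobP1_pt => /eq_ptP[c /colP wc].
have c1 : c = 1 by have := wc i; rewrite !mxE wi expr1n mulr1.
have /choice[a aE] : forall j, exists a, w j 0 = iota a.
  by move=> j; apply: frob_fixed; have := wc j; rewrite c1 scale1r mxE.
have wE : map_mx iota (\col_j a j) = w by apply/colP => j; rewrite !mxE aE.
by exists (\col_j a j); rewrite -?(map_mx_eq0 iota) wE.
Qed.

Definition invariant_counts (gamma : PGL2 k) (n : nat) : Prop :=
  let m := #[gamma]%g in
  let V : set (P1 K) := (~` FixP1 iota gamma)%classic in
  [/\ card_set (FixSets iota gamma (ratnsets k V n)) = a_ k V (n%:R / m%:R),
      (m %| card_set (Vk iota V))%N
    & card_set (FixSets iota gamma (ratnsets_rat iota V n))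
      = b_ iota V (card_set (Vk iota V) %/ m) (n%:R / m%:R)].

(** * The two counts, given a quotient map by gamma that commutes with Frobenius *)

Section Counting.
Variables (gamma : PGL2 k) (phi : P1 K -> P1 K).
Let V : set (P1 K) := (~` FixP1 iota gamma)%classic.
Let g := actP1 iota gamma.
Let m := #[gamma]%g.
Hypothesis g_free : forall x i, V x -> iter i g x = x <-> (m %| i)%N.
Hypothesis phiV : forall x, V x -> V (phi x).
Hypothesis phi_surj : forall y, V y -> exists2 x, V x & phi x = y.
Hypothesis phiF : forall x, V x -> phi (frobP1 k x) = frobP1 k (phi x).
Hypothesis phi_fiber : forall x y, V x -> V y ->
  phi x = phi y <-> exists i, y = iter i g x.

Let m_gt0 : (0 < m)%N. Proof. exact: order_gt0. Qed.

Let FV x : V x -> V (frobP1 k x).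
Proof.
by move=> Vx Fx; apply: Vx; apply: (frobP1_inj iota); rewrite frob_act.
Qed.

Let gV x : V x -> V (g x).
Proof. by move=> Vx gx; apply: Vx; exact: actP1_inj gx. Qed.

Let gS (S : {fset P1 K}) : [fset g x | x in S]%fset = S ->
  forall x, x \in S -> g x \in S.
Proof. by move=> SE x xS; rewrite -SE in_imfset. Qed.

Lemma card_fix_sets n (PX PY : set {fset P1 K}) :
  (forall S : {fset P1 K}, ([set` S] `<=` V)%classic ->
     (forall y, y \in S -> g y \in S) ->
     PX S <-> PY [fset phi x | x in S]%fset) ->
  card_set (FixSets iota gamma (ratnsets k V n `&` PX)%classic) =
  if (m %| n)%N then card_set (ratnsets k V (n %/ m) `&` PY)%classic else 0%N.
Proof.
move=> PXY; case: ifPn => [/dvdnP[d ->]|mn].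
  rewrite mulnK//; apply: (card_invariant_sets (n := d * m)
    m_gt0 (frobP1_inj iota) FV gV g_free phiV phi_surj phiF phi_fiber) PXY.
  - apply: sub_finite_set (finite_ratnsets iota V (d * m)) => S [[]] //.
  - by apply/seteqP; split=> S [] => [[[]]|SV []].
  - apply/seteqP; split=> S [] => [[SV Sd FS] PS|SV [Sd FS PS]].
      by split => //; split => //; rewrite Sd mulnC.
    split => //; split => //; apply/eqP.
    by rewrite -(eqn_pmul2l m_gt0) Sd mulnC.
(* An invariant set is a union of orbits of length m, so none exists when m does not divide n. *)
rewrite (_ : FixSets _ _ _ = set0) ?/card_set ?fset_set0 ?cardfs0//.
apply/seteqP; split => // S [[[SV Sn _] _] SE]; case/negP: mn.
rewrite -Sn (card_saturated m_gt0 gV g_free phiV phi_surj phi_fiber SV (gS SE)).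
exact: dvdn_mulr.
Qed.

Lemma quotient_counts n : (0 < n)%N ->
  invariant_counts gamma n.
Proof.
move=> n_gt0.
have [W WE] : exists W : {fset P1 K}, W = fset_set (Vk iota V).
  by exists (fset_set (Vk iota V)).
have inW x : x \in W <-> Vk iota V x.
  by rewrite WE in_fset_set ?inE//; exact: finite_Vk.
have WV : ([set` W] `<=` V)%classic by move=> x /inW[].
have gW x : x \in W -> g x \in W.
  move=> /inW[Vx /frobP1_rat Fx]; apply/inW; split; first exact: gV.
  by apply: frobP1_fixed; rewrite frob_act Fx.
have cW := card_saturated m_gt0 gV g_free phiV phi_surj phi_fiber WV gW.
have cVk : card_set (Vk iota V) = #|` W| by rewrite WE.
split.
- rewrite -[ratnsets k V n]setIT (@card_fix_sets n setT setT)// setIT.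
  by rewrite /a_ ext0_div.
- by rewrite cVk cW dvdn_mulr.
(* Compute b with the image of W = V(k). Its points are rational since [phi] commutes with
   Frobenius, and it has |W|/m elements since W is [g]-stable. *)
rewrite (@b_E _ _ _ _ _ [fset phi x | x in W]%fset); first last.
- by rewrite cVk cW mulKn.
- move=> _ /imfsetP[x /= /inW[Vx /frobP1_rat Fx] ->]; split; first exact: phiV.
  by apply: frobP1_fixed; rewrite -phiF// Fx.
rewrite ext0_div//; apply: card_fix_sets => S SV gS'; split.
  move=> [x [/= xS /inW xW]]; exists (phi x).
  by split; apply: in_imfset.
move=> [_ [/= /imfsetP[x /= xS ->]]] phix; exists x; split => //=; apply/inW.
move: phix; rewrite (mem_saturated phi_fiber WV gW)//.
exact: SV.
Qed.

End Counting.

(** * The quotient map written in an affine coordinate *)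

Section Chart.
Variables (gamma : PGL2 k) (psi : K -> P1 K) (ch : P1 K -> K) (U : set K).
Variables h f : K -> K.
Let V : set (P1 K) := (~` FixP1 iota gamma)%classic.
Let g := actP1 iota gamma.
Let m := #[gamma]%g.
Hypothesis psiK : cancel psi ch.
Hypothesis VE : V = (psi @` U)%classic.
Hypothesis psi_act : forall u, U u -> g (psi u) = psi (h u).
Hypothesis psi_frob : forall u, U u -> frobP1 k (psi u) = psi (f u).
Hypothesis h_unif : forall i u w, U u -> U w ->
  iter i h u = u -> iter i h w = w.

Let psiV u : V (psi u) <-> U u.
Proof.
rewrite VE; split=> [[w Uw /(can_inj psiK) <-]//|Uu].
by exists u.
Qed.

Let hU u : U u -> U (h u).
Proof.
move=> Uu; apply/psiV; rewrite -psi_act//.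
by have /psiV Vu := Uu => gx; apply: Vu; exact: actP1_inj gx.
Qed.

Let iter_psi i u : U u -> iter i g (psi u) = psi (iter i h u).
Proof.
move=> Uu; suff [] : U (iter i h u) /\ iter i g (psi u) = psi (iter i h u).
  by [].
by elim: i => //= i [Ui ->]; split; [exact: hU|exact: psi_act].
Qed.

(** By [h_unif], a power of gamma fixing one point of V fixes all of V. It also fixes the fixed
    points of gamma, hence the whole line, and the action is faithful. Thus every orbit in V has
    length exactly m. *)
Lemma chart_order i u : U u -> iter i h u = u <-> (m %| i)%N.
Proof.
move=> Uu; rewrite order_dvdn; split=> [hu|/eqP gi].
  apply/eqP/actP1_faithful => P; rewrite actP1_X.
  have [VP|/contrapT gP] := pselect (V P).
    have [w Uw <-] : (psi @` U)%classic P by rewrite -VE.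
    by rewrite iter_psi// (h_unif Uu Uw hu).
  by elim: i {hu} => //= i ->.
by apply: (can_inj psiK); rewrite -iter_psi// -actP1_X gi actP1_1.
Qed.

Lemma chart_counts (phi : K -> K) n : (0 < n)%N ->
  (forall u, U u -> U (phi u)) ->
  (forall w, U w -> exists2 u, U u & phi u = w) ->
  (forall u, U u -> phi (f u) = f (phi u)) ->
  (forall u w, U u -> U w -> phi u = phi w <-> exists i, w = iter i h u) ->
  invariant_counts gamma n.
Proof.
move=> n_gt0 phiU phi_surj phif phi_fiber.
have VP P : V P -> exists2 u, U u & P = psi u.
  by rewrite VE => -[u Uu <-]; exists u.
apply: (@quotient_counts gamma (psi \o phi \o ch)) n_gt0.
- move=> _ i /VP[u Uu ->]; rewrite iter_psi// -(chart_order i Uu).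
  by split=> [/(can_inj psiK)|->].
- by move=> _ /VP[u Uu ->]; apply/psiV; rewrite /= psiK; exact: phiU.
- move=> _ /VP[w /phi_surj[u Uu <-] ->].
  by exists (psi u); [exact/psiV|rewrite /= psiK].
- move=> _ /VP[u Uu ->].
  by rewrite psi_frob//= !psiK phif// psi_frob//; exact: phiU.
move=> _ _ /VP[u Uu ->] /VP[w Uw ->]; rewrite /= !psiK; split.
  move=> /(can_inj psiK)/(phi_fiber _ _ Uu Uw)[i ->]; exists i.
  by rewrite iter_psi.
move=> [i]; rewrite iter_psi// => /(can_inj psiK) E; congr psi.
by apply/(phi_fiber _ _ Uu Uw); exists i.
Qed.

(** The multiplicative case, with quotient map u |-> u^m, whose fibres are the cosets of the m-th
    roots of unity. *)
Lemma chart_mul n (z : K) : (0 < n)%N -> z != 0 ->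
  U = [set u | u != 0]%classic -> h = *%R z ->
  {in U, {morph f : u / u ^+ m >-> u ^+ m}} ->
  invariant_counts gamma n.
Proof.
move=> n_gt0 z0 UE hE fX.
have iterE i u : iter i h u = z ^+ i * u by rewrite hE iter_mulr.
have m_gt0 : (0 < m)%N by exact: order_gt0.
have U1 : U 1 by rewrite UE /= oner_eq0.
(* The orbit of u = 1 consists of the powers of z and has length m by [chart_order]. *)
have z_prim : m.-primitive_root z.
  apply/andP; split => //; apply/forallP => i; rewrite unity_rootE.
  have -> : (z ^+ i.+1 == 1) = (m %| i.+1)%N.
    have := chart_order i.+1 U1; rewrite iterE mulr1 => zm.
    by apply/eqP/idP => /zm.
  apply/eqP; apply/idP/eqP => [mi|->//].
  by apply/eqP; rewrite eqn_leq ltn_ord dvdn_leq.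
apply: (chart_counts (phi := fun u => u ^+ m) n_gt0).
- by rewrite UE => u /= u0; rewrite expf_neq0.
- rewrite UE => w /= w0.
  have /closed_rootP[u] : size ('X^m - w%:P : {poly K})%R != 1%N.
    by rewrite size_XnsubC// eqSS -lt0n.
  rewrite /root !hornerE subr_eq0 => /eqP um; exists u => //.
  by apply: contraNneq w0 => u0; rewrite -um u0 expr0n -(prednK m_gt0).
- by move=> u Uu; rewrite fX ?inE.
move=> u w; rewrite UE /= => u0 w0; split=> [uw|[i ->]]; last first.
  by rewrite iterE exprMn exprAC (prim_expr_order z_prim) expr1n mul1r.
have [] := prim_rootP z_prim (x := w / u).
  by rewrite expr_div_n -uw divff// expf_neq0.
by move=> i wu; exists i; rewrite iterE -wu divfK.
Qed.

(** The additive case, with the Artin-Schreier map u |-> u^p - u. It is additive with kernel the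
    prime field, so its fibres are the orbits of u |-> 1 + u. *)
Lemma chart_add n p : (0 < n)%N -> p \in [pchar K] ->
  U = setT -> h = +%R 1 -> f = (fun u => u ^+ #|k|) ->
  invariant_counts gamma n.
Proof.
move=> n_gt0 pK UE hE fE.
have iterE i u : iter i h u = i%:R + u by rewrite hE iter_addr.
have p_pr := pcharf_prime pK; have p_gt1 := prime_gt1 p_pr.
have UT u : U u by rewrite UE.
have fD : {morph (fun u : K => u ^+ p) : u v / u - v}.
  by move=> u v /=; rewrite exprDn_pchar ?exprNn_pchar ?pnatE//.
have sizeP (q : {poly K}) : (size q <= 2)%N -> size ('X^p + q) = p.+1.
  move=> q2; rewrite size_polyDl ?size_polyXn//.
  by rewrite (leq_ltn_trans q2).
have Ep i j : (i == j %[mod p])%N = (i%:R == j%:R :> K).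
  wlog ij : i j / (j <= i)%N.
    move=> W; case: (leqP j i) => [|/ltnW] ij; first exact: W.
    by rewrite eq_sym W// eq_sym.
  by rewrite eqn_mod_dvd// (dvdn_pcharf pK) natrB// subr_eq0.
(* The p elements of the prime field are already roots of X^p - X; a further root u would make p + 1
   of them. *)
have fixp (u : K) : u ^+ p = u -> exists i, u = i%:R.
  move=> up; apply: contrapT => /forallNP un.
  pose rs := u :: [seq i%:R | i <- seq.iota 0 p].
  have : (size rs < size ('X^p - 'X : {poly K})%R)%N.
    apply: max_poly_roots.
    - by rewrite -size_poly_eq0 sizeP// size_polyN size_polyX.
    - apply/allP => x; rewrite inE => /predU1P[->|/mapP[i _ ->]].
        by rewrite /root !hornerE up subrr.
      by rewrite /root !hornerE -(pFrobenius_autE pK) pFrobenius_aut_nat subrr.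
    rewrite /= map_inj_in_uniq ?iota_uniq ?andbT.
      by apply/negP => /mapP[i _ /un].
    move=> i j; rewrite !mem_iota /= !add0n => ip jp ij.
    by rewrite -(modn_small ip) -(modn_small jp); apply/eqP; rewrite Ep ij.
  by rewrite sizeP ?size_polyN ?size_polyX//= size_map size_iota ltnn.
apply: (chart_counts (phi := fun u => u ^+ p - u) n_gt0) => //.
- move=> w _.
  have /closed_rootP[u] :
    size ('X^p + (- 'X - w%:P) : {poly K})%R != 1%N.
    rewrite sizeP ?eqSS -?lt0n ?prime_gt0//.
    by rewrite -opprD size_polyN size_XaddC.
  rewrite /root !hornerE => /eqP uw; exists u => //.
  by apply/eqP; rewrite -subr_eq0 uw.
- by move=> u _; rewrite fE exprDn_pchar ?exprNn_pchar ?card_pchar_nat// exprAC.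
move=> u w _ _; split=> [uw|[i ->]]; last first.
  rewrite iterE exprDn_pchar ?pnatE// -(pFrobenius_autE pK i%:R).
  by rewrite pFrobenius_aut_nat; ring.
have [i wu] : exists i, w - u = i%:R.
  by apply: fixp; rewrite fD; move/eqP: uw; rewrite subr_eq => /eqP ->; ring.
by exists i; rewrite iterE -wu subrK.
Qed.

End Chart.

(** * The coordinate attached to a basis of eigenvectors or a Jordan basis *)

(* Coordinate u of the point spanned by u n1 + n2; it misses only the point   *)
(* spanned by n1.                                                             *)
Section BasisChart.
Variables (gamma : PGL2 k) (n1 n2 : 'cV[K]_2).
Hypothesis n12 : cross n1 n2 != 0.
Let A := map_mx iota (GLval (repr gamma)).
Let V : set (P1 K) := (~` FixP1 iota gamma)%classic.

Lemma affine_neq0 u : u *: n1 + n2 != 0.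
Proof.
apply: contraNneq n12 => u0.
have : cross n1 (u *: n1 + n2) = cross n1 n2.
  by rewrite crossDr crossZr crossvv mulr0 add0r.
by rewrite u0 crossC cross0l oppr0 => <-.
Qed.

Definition affine_pt u : P1 K := pt (affine_neq0 u).

Definition affine_coord (P : P1 K) : K :=
  cross (vpick (val P)) n2 / cross n1 (vpick (val P)).

Lemma affine_ptK : cancel affine_pt affine_coord.
Proof.
move=> u; rewrite /affine_coord.
have /vlineP[c vc] : vpick (val (affine_pt u)) \in <[u *: n1 + n2]>%VS.
  exact: memv_pick.
have c0 : c != 0.
  apply: contraNneq (vpick_neq0 (affine_pt u)) => c0.
  by rewrite vc c0 scale0r.
rewrite vc crossZl crossZr crossDl crossDr crossZl crossZr !crossvv mulr0.
by rewrite addr0 add0r mulrCA mulfK// mulf_neq0.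
Qed.

Lemma affine_ptE v (v0 : v != 0) : cross n1 v != 0 ->
  pt v0 = affine_pt (cross v n2 / cross n1 v).
Proof.
move=> n1v; apply/pt_eqE; rewrite crossDr crossZr (crossC n1 v) mulrN.
by rewrite divfK// addNr.
Qed.

(** The only point outside the chart is spanned by the eigenvector n1 and is fixed by gamma, so V
    lies entirely in the chart. *)
Lemma affine_image (l : K) (h : K -> K) : A *m n1 = l *: n1 ->
  (forall u, actP1 iota gamma (affine_pt u) = affine_pt (h u)) ->
  V = (affine_pt @` [set u | h u <> u])%classic.
Proof.
move=> An1 gE; apply/seteqP; split=> [P VP|_ [u hu <-]]; last first.
  by rewrite /V /FixP1 /= gE => /(can_inj affine_ptK).
have [v [v0 PE]] := P1_ptP P; rewrite PE in VP *.
have [n1v|n1v] := eqVneq (cross n1 v) 0; last first.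
  exists (cross v n2 / cross n1 v); last by rewrite -affine_ptE.
  by move=> hu; apply: VP; rewrite /FixP1 /= (affine_ptE v0 n1v) gE hu.
have n10 : n1 != 0 by apply: contraNneq n12 => ->; rewrite cross0l.
case: VP; rewrite /FixP1 /= -{1}(coset_reprK gamma) actP1_pt.
have /(cross_eq0P _ n10)[c vE] : cross v n1 == 0 by rewrite crossC n1v oppr0.
by apply/eq_ptP; exists l; rewrite vE -scalemxAr An1 !scalerA mulrC.
Qed.

(** Here gamma multiplies u by [l1 / l2]. Frobenius acts as u |-> u^q if it fixes both eigenvectors,
    and as u |-> u^(-q) if it exchanges them; both maps commute with m-th powers. *)
Lemma counts_semisimple (l1 l2 : K) n : (0 < n)%N ->
  l1 != l2 -> l1 != 0 -> l2 != 0 ->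
  A *m n1 = l1 *: n1 -> A *m n2 = l2 *: n2 ->
  (frob_mx k n1 = n1 /\ frob_mx k n2 = n2) \/
  (frob_mx k n1 = n2 /\ frob_mx k n2 = n1) ->
  invariant_counts gamma n.
Proof.
move=> n_gt0 l12 l10 l20 An1 An2 Fn.
pose z := l1 / l2.
have z1 : z - 1 != 0.
  rewrite subr_eq0; apply: contraNneq l12 => z1.
  by rewrite -[l1](divfK l20) -/z z1 mul1r.
have gE u : actP1 iota gamma (affine_pt u) = affine_pt (z * u).
  rewrite /affine_pt -(coset_reprK gamma) actP1_pt.
  apply/eq_ptP; exists l2; rewrite mulmxDr -scalemxAr -/A An1 An2.
  by rewrite scalerDr !scalerA; congr (_ *: _ + _); rewrite /z; field.
have UE : [set u | z * u <> u]%classic = [set u | u != 0]%classic.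
  apply/seteqP; split=> u /=.
    by apply: contra_notN => /eqP ->; rewrite mulr0.
  move=> u0 /eqP; rewrite -subr_eq0 -{2}[u]mul1r -mulrBl mulf_eq0.
  by rewrite (negPf z1) (negPf u0).
have [f [fE fX]] : exists f : K -> K,
    (forall u, u != 0 -> frobP1 k (affine_pt u) = affine_pt (f u)) /\
    forall m u, f (u ^+ m) = f u ^+ m.
  case: Fn => -[F1 F2].
    exists (fun u => u ^+ #|k|); split=> [u _|m u]; last by rewrite exprAC.
    rewrite frobP1_pt; apply/eq_ptP; exists 1.
    by rewrite frob_mxD frob_mxZ F1 F2 scale1r.
  (* Frobenius sends u n1 + n2 to u^q n2 + n1 = u^q (u^(-q) n1 + n2). *)
  exists (fun u => (u ^+ #|k|)^-1); split=> [u u0|m u].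
    rewrite frobP1_pt; apply/eq_ptP; exists (u ^+ #|k|).
    rewrite frob_mxD frob_mxZ F1 F2 scalerDr scalerA divff ?expf_neq0//.
    by rewrite scale1r addrC.
  by rewrite exprAC exprVn.
have z0 : z != 0 by rewrite mulf_neq0 ?invr_eq0.
apply: (chart_mul affine_ptK (affine_image An1 gE) (f := f) _ _ _ n_gt0 z0).
- by move=> u _; exact: gE.
- by rewrite UE => u; exact: fE.
- rewrite UE => i u w /= u0 _; rewrite !iter_mulr => /(canRL (mulfK u0)) ->.
  by rewrite divff// mul1r.
- exact: UE.
- by [].
- by move=> u _; exact: fX.
Qed.

Lemma counts_unipotent (l : K) n : (0 < n)%N -> l != 0 ->
  A *m n1 = l *: n1 -> A *m n2 = l *: (n1 + n2) ->
  frob_mx k n1 = n1 -> frob_mx k n2 = n2 ->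
  invariant_counts gamma n.
Proof.
move=> n_gt0 l0 An1 An2 F1 F2.
have gE u : actP1 iota gamma (affine_pt u) = affine_pt (1 + u).
  rewrite /affine_pt -(coset_reprK gamma) actP1_pt.
  apply/eq_ptP; exists l; rewrite mulmxDr -scalemxAr -/A An1 An2.
  rewrite !scalerDr !scalerA addrA mulrDr mulr1 scalerDl.
  by rewrite (addrC (l *: n1)) mulrC.
have UE : [set u | 1 + u <> u]%classic = setT :> set K.
  apply/seteqP; split=> u //= _ /eqP.
  by rewrite -subr_eq0 addrK oner_eq0.
have [p p_pr pk] := finPcharP k.
have pK : p \in [pchar K] by rewrite (fmorph_pchar iota).
apply: (chart_add affine_ptK (affine_image An1 gE) (f := fun u => u ^+ #|k|)
  _ _ _ n_gt0 pK UE) => // [u _|i u w _ _].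
- rewrite frobP1_pt; apply/eq_ptP; exists 1.
  by rewrite frob_mxD frob_mxZ F1 F2 scale1r.
- rewrite !iter_addr => /eqP; rewrite -subr_eq0 addrK => /eqP ->.
  by rewrite add0r.
Qed.

End BasisChart.

(** * Choice of the basis according to the eigenvalues *)

Lemma invariant_countsP (gamma : PGL2 k) (n : nat) : (2 \notin [pchar k])%N ->
  gamma != 1%g -> (0 < n)%N -> invariant_counts gamma n.
Proof.
move=> k2 /not_scalar_repr; set A := GLval (repr gamma).
have A_unit : A \in unitmx by exact: GL_unit.
move=> /nonscalar_cyclic[e eA] n_gt0.
(* The characteristic polynomial of A is X^2 - t X + d. *)
have [d [t AAe]] : exists d t, A *m (A *m e) = t *: (A *m e) - d *: e.
  have := cross_decomp (A *m (A *m e)) eA.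
  set a := _ / _; set b := _ / _ => AAe.
  by exists (- a), b; rewrite scaleNr opprK addrC.
(* If d = 0, cancelling A in A (A e) = t A e would make A e parallel to e. *)
have d0 : d != 0.
  apply: contraNneq eA => d0; move: AAe; rewrite d0 scale0r subr0 scalemxAr.
  move=> /(congr1 (mulmx (invmx A))); rewrite !mulKmx// => ->.
  by rewrite crossZr crossvv mulr0.
pose ie := map_mx iota e; pose iA := map_mx iota A; pose w := iA *m ie.
have wE : w = map_mx iota (A *m e) by rewrite map_mxM.
have Aw : iA *m w = iota t *: w - iota d *: ie.
  by rewrite wE -map_mxM AAe map_mxB !map_mxZ.
have few : frob_mx k ie = ie /\ frob_mx k w = w.
  by rewrite wE /frob_mx !frob_mx_map.
have ew : cross ie w != 0 by rewrite wE cross_map fmorph_eq0.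
have [l lE] : exists l, l ^+ 2 - iota t * l + iota d = 0.
  have /closed_rootP[l] :
      size (('X - (iota t)%:P) * 'X + (iota d)%:P : {poly K})%R != 1%N.
    by rewrite size_MXaddC polyXsubC_eq0 size_XsubC.
  rewrite /root !hornerE => /eqP lE; exists l; rewrite -[RHS]lE.
  by ring.
(* In this proof [m] is the second eigenvalue, not the order of gamma. *)
pose m := iota t - l.
have lm : l * m = iota d by rewrite -[RHS]subr0 -lE /m; ring.
have [l0 m0] : l != 0 /\ m != 0.
  by apply/andP; rewrite -negb_or -mulf_eq0 lm fmorph_eq0.
(* By Cayley-Hamilton (A - x)(A - y) = 0, so (A - y) e is an eigenvector for x. *)
have A_eig x y : x + y = iota t -> x * y = iota d ->
    iA *m (w - y *: ie) = x *: (w - y *: ie).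
  move=> xy_t xy_d; rewrite mulmxBr -scalemxAr Aw -/w -xy_t -xy_d.
  by rewrite scalerBr scalerDl scalerA addrAC addrK.
have frobB x : frob_mx k (w - x *: ie) = w - x ^+ #|k| *: ie.
  have [Fe Fw] := few; rewrite -[- (x *: ie)]scaleNr frob_mxD frob_mxZ Fe Fw.
  by rewrite exprNn_pchar ?card_pchar_nat// scaleNr.
(* A double eigenvalue is t / 2, which lies in k since 2 is invertible there. *)
have [lm_eq|lm_neq] := eqVneq l m.
  have [a lE'] : exists a, l = iota a.
    exists (t / 2); have l2 : l *+ 2 = iota t.
      by rewrite mulr2n {2}lm_eq /m addrC subrK.
    have k20 : 2 != 0 :> k by move: k2; rewrite inE.
    rewrite fmorph_div rmorph_nat -l2 -mulr_natr mulfK//.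
    by rewrite -(rmorph_nat iota) fmorph_eq0.
  have lq : l ^+ #|k| = l by rewrite lE' -rmorphXn expf_card.
  (* The second vector is l e rather than e, so that A n2 = l A e = l (n1 + n2) and gamma translates
     u by exactly 1. *)
  apply: (@counts_unipotent _ (w - l *: ie) (l *: ie) _ l) => //.
  - rewrite crossZr crossDl -scaleNr crossZl crossvv mulr0 addr0 crossC mulrN.
    by rewrite oppr_eq0 mulf_neq0.
  - by apply: A_eig; [rewrite {2}lm_eq /m addrC subrK|rewrite {2}lm_eq].
  - by rewrite subrK -scalemxAr.
  - by rewrite frobB lq.
  - by rewrite frob_mxZ lq (proj1 few).
(* The q-th power map is a ring morphism fixing t and d, so it permutes the eigenvalues. *)
have root_q x : x ^+ 2 - iota t * x + iota d = 0 ->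
    x ^+ #|k| = l \/ x ^+ #|k| = m.
  move=> xE; have : (x ^+ #|k| - l) * (x ^+ #|k| - m) = 0.
    have iq a : iota a ^+ #|k| = iota a by rewrite -rmorphXn expf_card.
    have := congr1 (fun y => y ^+ #|k|) xE.
    rewrite !(exprDn_pchar, exprNn_pchar) ?card_pchar_nat// exprMn iq expr0n.
    rewrite exprMn iq -(prednK (ltnW (finNzRing_gt1 k))) mulr0n => xq.
    by rewrite -[RHS]xq -lm /m; ring.
  by move/eqP; rewrite mulf_eq0 !subr_eq0 => /orP[]/eqP; [left|right].
have mE : m ^+ 2 - iota t * m + iota d = 0.
  by rewrite -[RHS]lE /m; ring.
(* A e - m e and A e - l e are eigenvectors, and conjugation exchanges them   *)
(* exactly when it exchanges l and m.                                         *)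
apply: (@counts_semisimple _ (w - m *: ie) (w - l *: ie) _ l m) => //.
- rewrite -!scaleNr crossDl !crossDr !crossZl !crossZr !crossvv.
  rewrite (crossC ie w) (_ : _ + _ = (l - m) * cross ie w); last by ring.
  by rewrite mulf_neq0// subr_eq0.
- by apply: A_eig; rewrite // addrC subrK.
- by apply: A_eig; rewrite ?subrK// mulrC.
(* In the two mixed cases l and m would have the same q-th power, against injectivity. *)
have [lq|lq] := root_q _ lE; have [mq|mq] := root_q _ mE.
- by case/eqP: lm_neq; apply: (frob_inj iota); rewrite /= lq.
- by left; rewrite !frobB lq mq.
- by right; rewrite !frobB lq mq.
- by case/eqP: lm_neq; apply: (frob_inj iota); rewrite /= lq.
Qed.

End ProjectiveLine.

Theorem theorem1p3 (k : finFieldType) (hk : (2 \notin [pchar k])%N)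
  (K : closedFieldType) (iota : {rmorphism k -> K})
  (algK : integralRange iota)
  (gamma : PGL2 k) (hgamma : gamma != 1%g) (n : nat) (hn : (0 < n)%N) :
  let m := #[gamma]%g in
  let V : set (P1 K) := (~` FixP1 iota gamma)%classic in
  [/\ card_set (FixSets iota gamma (ratnsets k V n)) = a_ k V (n%:R / m%:R),
      (m %| card_set (Vk iota V))%N
    & card_set (FixSets iota gamma (ratnsets_rat iota V n))
      = b_ iota V (card_set (Vk iota V) %/ m) (n%:R / m%:R)].
Proof. exact: invariant_countsP. Qed.
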